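(* Let $\mathcal{B}=(\mathcal{B},\mathbb{E},\mathfrak{s})$ be a weakly idempotent complete extriangulated category, $\Omega$ the class of hereditary complete cotorsion pairs $(\mathcal{X},\mathcal{Y})$ in $\mathcal{B}$ with $\omega=\mathcal{X}\cap\mathcal{Y}$ contravariantly finite in $\mathcal{B}$, and $\Gamma$ the class of weakly projective model structures on $\mathcal{B}$. Then the map $$\Phi:(\mathcal{X},\mathcal{Y})\mapsto(\mathrm{CoFib}_\omega,\mathrm{Fib}_\omega,\mathrm{Weq}_\omega)$$ is a bijection between $\Omega$ and $\Gamma$, with inverse $$\Psi:(\mathrm{CoFib},\mathrm{Fib},\mathrm{Weq})\mapsto(\mathcal{C},\mathrm{T}\mathcal{F}),$$ where $\mathcal{C}$ and $\mathrm{T}\mathcal{F}$ are respectively the class of cofibrant objects and the class of trivially fibrant objects of the model structure $(\mathrm{CoFib},\mathrm{Fib},\mathrm{Weq})$. Here, for $(\mathcal{X},\mathcal{Y})\in\Omega$ and $\omega=\mathcal{X}\cap\mathcal{Y}$: $\mathrm{CoFib}_\omega=\{f: A\to B\mid f$ is an inflation with $\mathrm{Cone}(f)\in\mathcal{X}\}$; $\mathrm{Fib}_\omega=\{f: A\to B\mid \mathcal{B}(W,f):\mathcal{B}(W,A)\to\mathcal{B}(W,B)$ is surjective for every $W\in\omega\}$; $\mathrm{Weq}_\omega=\{f: A\to B\mid$ there is a deflation $(f,t): A\oplus W\to B$ with $W\in\omega$ and $\mathrm{CoCone}(f,t)\in\mathcal{Y}\}$.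
   Context: Extriangulated category (Nakaoka–Palu): a triple $(\mathcal{B},\mathbb{E},\mathfrak{s})$ with $\mathcal{B}$ an additive category, $\mathbb{E}:\mathcal{B}^{op}\times\mathcal{B}\to\mathrm{Ab}$ an additive bifunctor (write $a_*\delta=\mathbb{E}(C,a)(\delta)$, $c^*\delta=\mathbb{E}(c,A)(\delta)$ for $\delta\in\mathbb{E}(C,A)$; a morphism $\delta\to\delta'$ is a pair $(a,c)$ with $a_*\delta=c^*\delta'$), and $\mathfrak{s}$ assigning to each $\delta\in\mathbb{E}(C,A)$ an equivalence class $[A\to B\to C]$ of sequences (two sequences are equivalent if they are related by an isomorphism of middle terms compatible with identities on the ends), such that: (ET2) every morphism $(a,c):\delta\to\delta'$ is completed by some $b$ to a commutative morphism $(a,b,c)$ of realizing sequences, $\mathfrak{s}(0)=[A\to A\oplus C\to C]$, and $\mathfrak{s}(\delta\oplus\delta')=\mathfrak{s}(\delta)\oplus\mathfrak{s}(\delta')$; (ET3) if $A\xrightarrow{x}B\xrightarrow{y}C$ realizes $\delta$, $A'\xrightarrow{x'}B'\xrightarrow{y'}C'$ realizes $\delta'$ and $bx=x'a$, then there is $c$ with $cy=y'b$ and $a_*\delta=c^*\delta'$; (ET3)$^{op}$ the dual; (ET4) if $A\xrightarrow{f}B\xrightarrow{f'}D$ realizes $\delta$ and $B\xrightarrow{g}C\xrightarrow{g'}F$ realizes $\delta'$, then there are an object $E$, morphisms $d:D\to E$, $e:E\to F$, $h'\colon C\to E$ with $h'g=df'$, $eh'=g'$, and $\delta''\in\mathbb{E}(E,A)$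 realized by $A\xrightarrow{gf}C\xrightarrow{h'}E$, such that $D\xrightarrow{d}E\xrightarrow{e}F$ realizes $f'_*\delta'$, $d^*\delta''=\delta$, $f_*\delta''=e^*\delta'$; (ET4)$^{op}$ the dual. A conflation is a sequence $A\xrightarrow{x}B\xrightarrow{y}C$ realizing some $\delta\in\mathbb{E}(C,A)$; $x$ is an inflation, $y$ a deflation, $\mathrm{Cone}(x)=C$, $\mathrm{CoCone}(y)=A$. $\mathcal{B}$ is weakly idempotent complete if every retraction has a kernel (equivalently every section has a cokernel). Cotorsion pair: a pair $(\mathcal{X},\mathcal{Y})$ of full additive subcategories closed under isomorphisms and direct summands with $\mathcal{X}^\perp=\mathcal{Y}$ and ${}^\perp\mathcal{Y}=\mathcal{X}$, where $\mathcal{X}^\perp=\{Z\mid\mathbb{E}(X,Z)=0\ \forall X\in\mathcal{X}\}$, ${}^\perp\mathcal{Y}=\{Z\mid\mathbb{E}(Z,Y)=0\ \forall Y\in\mathcal{Y}\}$. It is complete if each $C\in\mathcal{B}$ admits conflations $Y_C\to X_C\to C$ and $C\to Y^C\to X^C$ with $X_C,X^C\in\mathcal{X}$, $Y_C,Y^C\in\mathcal{Y}$; it is hereditary if for every conflation $A\to B\to C$: $B,C\in\mathcal{X}$ implies $A\in\mathcal{X}$, and $A,B\in\mathcal{Y}$ implies $C\in\mathcal{Y}$. $\omega$ is contravariantly finite in $\mathcal{B}$ if every $B\in\mathcal{B}$ has a morphism $t:W\to B$ with $W\in\omega$ through which every morphism $W'\to B$ with $W'\in\omega$ factors. Model structure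 on a category: a triple $(\mathrm{CoFib},\mathrm{Fib},\mathrm{Weq})$ of classes of morphisms satisfying the two-out-of-three axiom for $\mathrm{Weq}$; closure of each class under retracts; lifting ($\mathrm{CoFib}$ has the left lifting property against $\mathrm{Fib}\cap\mathrm{Weq}$, and $\mathrm{CoFib}\cap\mathrm{Weq}$ against $\mathrm{Fib}$); factorization (each morphism is $pi$ with $i\in\mathrm{CoFib}\cap\mathrm{Weq}$, $p\in\mathrm{Fib}$, and $qj$ with $j\in\mathrm{CoFib}$, $q\in\mathrm{Fib}\cap\mathrm{Weq}$). No existence of limits or colimits is required. $X$ is cofibrant if $0\to X\in\mathrm{CoFib}$, fibrant if $X\to0\in\mathrm{Fib}$, trivial if $0\to X\in\mathrm{Weq}$, trivially fibrant if trivial and fibrant. Trivial fibrations are the morphisms in $\mathrm{Fib}\cap\mathrm{Weq}$. A model structure on $\mathcal{B}$ is weakly projective if cofibrations are precisely the inflations with cofibrant cone, trivial fibrations are precisely the deflations with trivially fibrant cocone, and each object is fibrant. *)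

(* Defs.v *)
From mathcomp Require Import all_boot all_algebra.
From mathcomp Require Import boolp classical_sets functions.

Set Implicit Arguments.
Unset Strict Implicit.
Unset Printing Implicit Defensive.

Import GRing.Theory.

Local Open Scope classical_set_scope.
Local Open Scope ring_scope.

Declare Scope cat_scope.
Local Open Scope cat_scope.

(* Every abelian group carries a zmodType structure (classically the choice
   structure is no restriction), so Hom-groups are taken in zmodType. *)
Record preadditive_category := PreadditiveCategory {
  obj :> Type;
  hom : obj -> obj -> zmodType;
  idm : forall A : obj, hom A A;
  compm : forall A B C : obj, hom B C -> hom A B -> hom A C;
  compmA : forall A B C D (h : hom C D) (g : hom B C) (f : hom A B),
    compm h (compm g f) = compm (compm h g) f;
  comp1m : forall A B (f : hom A B), compm (idm B) f = f;
  compm1 : forall A B (f : hom A B), compm f (idm A) = f;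
  compmDl : forall A B C (g g' : hom B C) (f : hom A B),
    compm (g + g') f = compm g f + compm g' f;
  compmDr : forall A B C (g : hom B C) (f f' : hom A B),
    compm g (f + f') = compm g f + compm g f'
}.

Arguments hom {p} A B.
Arguments idm {p} A.
Arguments compm {p A B C} g f.

Notation "g \oc f" := (compm g f) (at level 40, left associativity) : cat_scope.

Record additive_category := AdditiveCategory {
  addcat :> preadditive_category;
  zobj : addcat;
  zobj_initial : forall (A : addcat) (f : hom zobj A), f = 0;
  zobj_terminal : forall (A : addcat) (f : hom A zobj), f = 0;
  biprod : addcat -> addcat -> addcat;
  binl : forall A B : addcat, hom A (biprod A B);
  binr : forall A B : addcat, hom B (biprod A B);
  bprl : forall A B : addcat, hom (biprod A B) A;
  bprr : forall A B : addcat, hom (biprod A B) B;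
  binlK : forall A B, bprl A B \oc binl A B = idm A;
  binrK : forall A B, bprr A B \oc binr A B = idm B;
  biprod_id : forall A B,
    binl A B \oc bprl A B + binr A B \oc bprr A B = idm (biprod A B)
}.

Arguments zobj {a}.
Arguments biprod {a} A B.
Arguments binl {a} A B.
Arguments binr {a} A B.
Arguments bprl {a} A B.
Arguments bprr {a} A B.

Notation "A :+: B" := (biprod A B) (at level 50, left associativity) : cat_scope.

Section AdditiveCategoryTheory.
Variable B : additive_category.
Implicit Types X Y Z W : B.

Definition is_iso X Y (f : hom X Y) : Prop :=
  exists g : hom Y X, g \oc f = idm X /\ f \oc g = idm Y.

Definition isomorphic X Y : Prop := exists f : hom X Y, is_iso f.

Definition bimap X X' Y Y' (f : hom X Y) (g : hom X' Y') :
    hom (X :+: X') (Y :+: Y') :=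
  binl Y Y' \oc f \oc bprl X X' + binr Y Y' \oc g \oc bprr X X'.

Definition copair X W Y (f : hom X Y) (t : hom W Y) : hom (X :+: W) Y :=
  f \oc bprl X W + t \oc bprr X W.

Definition is_kernel K X Y (k : hom K X) (f : hom X Y) : Prop :=
  f \oc k = 0 /\
  forall Z (z : hom Z X), f \oc z = 0 -> exists! u : hom Z K, k \oc u = z.

Definition is_retraction X Y (r : hom X Y) : Prop :=
  exists s : hom Y X, r \oc s = idm Y.

Definition weakly_idempotent_complete : Prop :=
  forall X Y (r : hom X Y), is_retraction r ->
    exists (K : B) (k : hom K X), is_kernel k r.

Definition seq_equiv (A C M M' : B) (x : hom A M) (y : hom M C)
    (x' : hom A M') (y' : hom M' C) : Prop :=
  exists b : hom M M', [/\ is_iso b, b \oc x = x' & y' \oc b = y].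

End AdditiveCategoryTheory.

Arguments weakly_idempotent_complete B : clear implicits.

(* [ext C A] is E(C,A), contravariant in C and covariant in A. *)
Record additive_bifunctor (B : additive_category) := AdditiveBifunctor {
  ext :> B -> B -> zmodType;
  push : forall C A A' : B, hom A A' -> {additive ext C A -> ext C A'};
  pull : forall C C' A : B, hom C' C -> {additive ext C A -> ext C' A};
  push1 : forall C A (d : ext C A), push C (idm A) d = d;
  push_comp : forall C A A' A'' (a' : hom A' A'') (a : hom A A') (d : ext C A),
    push C (a' \oc a) d = push C a' (push C a d);
  pushD : forall C A A' (a a' : hom A A') (d : ext C A),
    push C (a + a') d = push C a d + push C a' d;
  pull1 : forall C A (d : ext C A), pull A (idm C) d = d;
  pull_comp : forall C C' C'' A (c : hom C' C) (c' : hom C'' C') (d : ext C A),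
    pull A (c \oc c') d = pull A c' (pull A c d);
  pullD : forall C C' A (c c' : hom C' C) (d : ext C A),
    pull A (c + c') d = pull A c d + pull A c' d;
  push_pull : forall C C' A A' (a : hom A A') (c : hom C' C) (d : ext C A),
    push C' a (pull A c d) = pull A' c (push C a d)
}.

Arguments ext {B} E C A : rename.
Arguments push {B} E {C A A'} a : rename.
Arguments pull {B} E {C C' A} c : rename.

Section Realizations.
Variables (B : additive_category) (E : additive_bifunctor B).

Definition ext_sum (A C A' C' : B) (d : E C A) (d' : E C' A') :
    E (C :+: C') (A :+: A') :=
  push E (binl A A') (pull E (bprl C C') d)
  + push E (binr A A') (pull E (bprr C C') d').

(* [s d x y] means that the sequence A -x-> M -y-> C belongs to s(d). *)
Definition realization :=
  forall A C : B, E C A -> forall M : B, hom A M -> hom M C -> Prop.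

Variable s : realization.
Arguments s {A C} _ {M} _ _.

Definition equivalence_class_valued : Prop :=
  forall (A C : B) (d : E C A),
  exists (M : B) (x : hom A M) (y : hom M C),
  forall (M' : B) (x' : hom A M') (y' : hom M' C),
    s d x' y' <-> seq_equiv x y x' y'.

Definition morphisms_realized : Prop :=
  forall (A M C A' M' C' : B) (d : E C A) (d' : E C' A')
    (x : hom A M) (y : hom M C) (x' : hom A' M') (y' : hom M' C')
    (a : hom A A') (c : hom C C'),
  s d x y -> s d' x' y' -> push E a d = pull E c d' ->
  exists b : hom M M', b \oc x = x' \oc a /\ c \oc y = y' \oc b.

Definition zero_realized_split : Prop :=
  forall A C : B, s (0 : E C A) (binl A C) (bprr A C).

Definition sums_realized : Prop :=
  forall (A M C A' M' C' : B) (d : E C A) (d' : E C' A')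
    (x : hom A M) (y : hom M C) (x' : hom A' M') (y' : hom M' C'),
  s d x y -> s d' x' y' -> s (ext_sum d d') (bimap x x') (bimap y y').

Definition ET2 : Prop :=
  [/\ equivalence_class_valued, morphisms_realized,
      zero_realized_split & sums_realized].

Definition ET3 : Prop :=
  forall (A M C A' M' C' : B) (d : E C A) (d' : E C' A')
    (x : hom A M) (y : hom M C) (x' : hom A' M') (y' : hom M' C')
    (a : hom A A') (b : hom M M'),
  s d x y -> s d' x' y' -> b \oc x = x' \oc a ->
  exists c : hom C C', c \oc y = y' \oc b /\ push E a d = pull E c d'.

Definition ET3op : Prop :=
  forall (A M C A' M' C' : B) (d : E C A) (d' : E C' A')
    (x : hom A M) (y : hom M C) (x' : hom A' M') (y' : hom M' C')
    (b : hom M M') (c : hom C C'),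
  s d x y -> s d' x' y' -> c \oc y = y' \oc b ->
  exists a : hom A A', b \oc x = x' \oc a /\ push E a d = pull E c d'.

Definition ET4 : Prop :=
  forall (A M D N F : B) (d1 : E D A) (d2 : E F M)
    (f : hom A M) (f' : hom M D) (g : hom M N) (g' : hom N F),
  s d1 f f' -> s d2 g g' ->
  exists (G : B) (d : hom D G) (e : hom G F) (h' : hom N G) (d3 : E G A),
    [/\ h' \oc g = d \oc f', e \oc h' = g' & s d3 (g \oc f) h'] /\
    [/\ s (push E f' d2) d e, pull E d d3 = d1 & push E f d3 = pull E e d2].

(* The statement of ET4 in the opposite category, all arrows reversed and
   names kept. *)
Definition ET4op : Prop :=
  forall (A M D N F : B) (d1 : E A D) (d2 : E M F)
    (f : hom M A) (f' : hom D M) (g : hom N M) (g' : hom F N),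
  s d1 f' f -> s d2 g' g ->
  exists (G : B) (d : hom G D) (e : hom F G) (h' : hom G N) (d3 : E A G),
    [/\ g \oc h' = f' \oc d, h' \oc e = g' & s d3 h' (f \oc g)] /\
    [/\ s (pull E f' d2) e d, push E d d3 = d1 & pull E f d3 = push E e d2].

End Realizations.

Record extriangulated_category := ExtriangulatedCategory {
  excat :> additive_category;
  Ext : additive_bifunctor excat;
  real : realization Ext;
  exET2 : ET2 real;
  exET3 : ET3 real;
  exET3op : ET3op real;
  exET4 : ET4 real;
  exET4op : ET4op real
}.

Arguments Ext {e}.
Arguments real {e A C} d {M} x y : rename.

Definition mor_class (B : additive_category) :=
  forall X Y : B, set (hom X Y).

Record mor_triple (B : additive_category) := MorTriple {
  cofib : mor_class B;
  fib : mor_class B;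
  weq : mor_class B
}.

Arguments cofib {B} m [X Y] _ : rename.
Arguments fib {B} m [X Y] _ : rename.
Arguments weq {B} m [X Y] _ : rename.

Section ModelStructures.
Variable B : additive_category.
Implicit Types (P L R : mor_class B) (T : mor_triple B).

Definition meet_class P L : mor_class B := fun X Y => @P X Y `&` @L X Y.

Definition triv_cofib T := meet_class (cofib T) (weq T).
Definition triv_fib T := meet_class (fib T) (weq T).

Definition two_out_of_three P : Prop :=
  forall (X Y Z : B) (f : hom X Y) (g : hom Y Z),
  [/\ P _ _ f -> P _ _ g -> P _ _ (g \oc f),
      P _ _ f -> P _ _ (g \oc f) -> P _ _ g
    & P _ _ g -> P _ _ (g \oc f) -> P _ _ f].

Definition retract_of (X Y X' Y' : B) (f : hom X Y) (g : hom X' Y') : Prop :=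
  exists (i : hom X X') (r : hom X' X) (j : hom Y Y') (q : hom Y' Y),
    [/\ r \oc i = idm X, q \oc j = idm Y,
        g \oc i = j \oc f & f \oc r = q \oc g].

Definition retract_closed P : Prop :=
  forall (X Y X' Y' : B) (f : hom X Y) (g : hom X' Y'),
  retract_of f g -> P _ _ g -> P _ _ f.

Definition lifting L R : Prop :=
  forall (X Y X' Y' : B) (i : hom X Y) (p : hom X' Y')
    (u : hom X X') (v : hom Y Y'),
  L _ _ i -> R _ _ p -> p \oc u = v \oc i ->
  exists h : hom Y X', h \oc i = u /\ p \oc h = v.

Definition factorization L R : Prop :=
  forall (X Y : B) (f : hom X Y),
  exists (Z : B) (i : hom X Z) (p : hom Z Y),
    [/\ L _ _ i, R _ _ p & f = p \oc i].

Record model_structure T : Prop := ModelStructure {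
  model_weq_2of3 : two_out_of_three (weq T);
  model_cofib_retract : retract_closed (cofib T);
  model_fib_retract : retract_closed (fib T);
  model_weq_retract : retract_closed (weq T);
  model_lift_cofib : lifting (cofib T) (triv_fib T);
  model_lift_triv_cofib : lifting (triv_cofib T) (fib T);
  model_fact_triv_cofib : factorization (triv_cofib T) (fib T);
  model_fact_triv_fib : factorization (cofib T) (triv_fib T)
}.

Definition cofibrant T : set B := [set X | cofib T (0 : hom zobj X)].
Definition fibrant T : set B := [set X | fib T (0 : hom X zobj)].
Definition trivial T : set B := [set X | weq T (0 : hom zobj X)].
Definition triv_fibrant T : set B := trivial T `&` fibrant T.

End ModelStructures.

Section CotorsionPairs.
Variable B : extriangulated_category.
Implicit Types (X Y W : set B) (XY : set B * set B) (T : mor_triple B).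

Definition conflation (A M C : B) (x : hom A M) (y : hom M C) : Prop :=
  exists d : Ext C A, real d x y.

(* Cones and cocones are defined up to isomorphism only. *)
Definition inflation_with_cone X (A M : B) (x : hom A M) : Prop :=
  exists (C : B) (y : hom M C), conflation x y /\ X C.

Definition deflation_with_cocone Y (M C : B) (y : hom M C) : Prop :=
  exists (A : B) (x : hom A M), conflation x y /\ Y A.

Definition right_perp X : set B :=
  [set Z | forall A : B, X A -> forall d : Ext A Z, d = 0].

Definition left_perp Y : set B :=
  [set Z | forall A : B, Y A -> forall d : Ext Z A, d = 0].

Definition additive_subcategory X : Prop :=
  X zobj /\ forall A A' : B, X A -> X A' -> X (A :+: A').

Definition iso_closed X : Prop :=
  forall A A' : B, isomorphic A A' -> X A -> X A'.

Definition summand_closed X : Prop :=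
  forall A S S' : B, isomorphic A (S :+: S') -> X A -> X S.

Record cotorsion_pair X Y : Prop := CotorsionPair {
  cotorsion_additivel : additive_subcategory X;
  cotorsion_additiver : additive_subcategory Y;
  cotorsion_isol : iso_closed X;
  cotorsion_isor : iso_closed Y;
  cotorsion_summandl : summand_closed X;
  cotorsion_summandr : summand_closed Y;
  cotorsion_right_perp : right_perp X = Y;
  cotorsion_left_perp : left_perp Y = X
}.

Definition complete X Y : Prop :=
  forall C : B,
  (exists (YC XC : B) (x : hom YC XC) (y : hom XC C),
     [/\ conflation x y, X XC & Y YC]) /\
  (exists (YC XC : B) (x : hom C YC) (y : hom YC XC),
     [/\ conflation x y, X XC & Y YC]).

Definition hereditary X Y : Prop :=
  forall (A M C : B) (x : hom A M) (y : hom M C), conflation x y ->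
  (X M -> X C -> X A) /\ (Y A -> Y M -> Y C).

Definition contravariantly_finite W : Prop :=
  forall C : B, exists (D : B) (t : hom D C), W D /\
  forall (D' : B) (t' : hom D' C), W D' -> exists u : hom D' D, t' = t \oc u.

Definition Omega : set (set B * set B) :=
  [set XY | [/\ cotorsion_pair XY.1 XY.2, complete XY.1 XY.2,
                hereditary XY.1 XY.2
              & contravariantly_finite (XY.1 `&` XY.2)]].

Record weakly_projective T : Prop := WeaklyProjective {
  wproj_cofib : forall (A M : B) (f : hom A M),
    cofib T f <-> inflation_with_cone (cofibrant T) f;
  wproj_triv_fib : forall (A M : B) (f : hom A M),
    (fib T f /\ weq T f) <-> deflation_with_cocone (triv_fibrant T) f;
  wproj_fibrant : forall A : B, fibrant T A
}.

Definition Gamma : set (mor_triple B) :=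
  [set T | model_structure T /\ weakly_projective T].

Definition CoFib_ X : mor_class B :=
  fun A M => [set f | inflation_with_cone X f].

Definition Fib_ W : mor_class B :=
  fun A M => [set f | forall D : B, W D ->
    forall g : hom D M, exists h : hom D A, f \oc h = g].

Definition Weq_ W Y : mor_class B :=
  fun A M => [set f | exists (D : B) (t : hom D M),
    W D /\ deflation_with_cocone Y (copair f t)].

Definition Phi XY : mor_triple B :=
  let W := XY.1 `&` XY.2 in MorTriple (CoFib_ XY.1) (Fib_ W) (Weq_ W XY.2).

Definition Psi T : set B * set B := (cofibrant T, triv_fibrant T).

End CotorsionPairs.

Arguments Omega B : clear implicits.
Arguments Gamma B : clear implicits.

(* Main.v *)
Require Import Defs.
From mathcomp Require Import all_boot ssralg.
From mathcomp Require Import boolp classical_sets functions.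

(* From (X, Y) to a model structure: a morphism f lies in Weq_omega iff
   Hom(P, f) is bijective modulo omega for every P in X.  With this description
   two-out-of-three and the retract axiom for Weq_omega are formal.  Trivial
   fibrations are the deflations with cocone in Y: if t factors through f, then
   (f, t) is f after a retraction, and by weak idempotent completeness f is a
   deflation as soon as such a composite is.  Trivial cofibrations are the split
   inflations with cone in omega.

   From a model structure to (C, TF): orthogonality is a lifting problem, the
   factorizations of 0 -> A and A -> 0 give completeness, and heredity of TF is
   two-out-of-three.  Every object being fibrant, a trivial cofibration splits
   and its cone is in omega, so the fibrations are Fib_omega; the weak
   equivalences are then the composites of a trivial cofibration and a trivial
   fibration. *)

Set Implicit Arguments.
Unset Strict Implicit.
Unset Printing Implicit Defensive.

Import GRing.Theory.

Local Open Scope ring_scope.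
Local Open Scope cat_scope.

(** * Additive categories, bifunctors and realizations *)

Section Preadditive.
Variable B : preadditive_category.
Implicit Types X Y Z : B.

Lemma comp0m X Y Z (f : hom X Y) : (0 : hom Y Z) \oc f = 0.
Proof. by apply: (addrI (0 \oc f)); rewrite -compmDl !addr0. Qed.

Lemma compm0 X Y Z (g : hom Y Z) : g \oc (0 : hom X Y) = 0.
Proof. by apply: (addrI (g \oc 0)); rewrite -compmDr !addr0. Qed.

Lemma compNm X Y Z (g : hom Y Z) (f : hom X Y) : (- g) \oc f = - (g \oc f).
Proof. by apply: (addrI (g \oc f)); rewrite -compmDl !subrr comp0m. Qed.

Lemma compmN X Y Z (g : hom Y Z) (f : hom X Y) : g \oc (- f) = - (g \oc f).
Proof. by apply: (addrI (g \oc f)); rewrite -compmDr !subrr compm0. Qed.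

Lemma compmBl X Y Z (g g' : hom Y Z) (f : hom X Y) :
  (g - g') \oc f = g \oc f - g' \oc f.
Proof. by rewrite compmDl compNm. Qed.

Lemma compmBr X Y Z (g : hom Y Z) (f f' : hom X Y) :
  g \oc (f - f') = g \oc f - g \oc f'.
Proof. by rewrite compmDr compmN. Qed.

End Preadditive.

Section Additive.
Variable B : additive_category.
Implicit Types X Y Z W : B.

Lemma from_zobj X (f g : hom zobj X) : f = g.
Proof. by rewrite (zobj_initial f) (zobj_initial g). Qed.

Lemma to_zobj X (f g : hom X zobj) : f = g.
Proof. by rewrite (zobj_terminal f) (zobj_terminal g). Qed.

Lemma bprr_binl X Y : bprr X Y \oc binl X Y = 0.
Proof.
have := congr1 (fun f => bprr X Y \oc f \oc binl X Y) (biprod_id X Y).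
rewrite /= compmDr compmDl !compmA binrK comp1m compm1.
rewrite -(compmA (bprr _ _ \oc binl _ _)) binlK compm1 => e.
by apply: (addrI (bprr X Y \oc binl X Y)); rewrite addr0.
Qed.

Lemma bprl_binr X Y : bprl X Y \oc binr X Y = 0.
Proof.
have := congr1 (fun f => bprl X Y \oc f \oc binr X Y) (biprod_id X Y).
rewrite /= compmDr compmDl !compmA binlK comp1m compm1.
rewrite -(compmA (bprl _ _ \oc binr _ _)) binrK compm1 => e.
by apply: (addrI (bprl X Y \oc binr X Y)); rewrite addr0.
Qed.

Lemma copair_binl X W Y (f : hom X Y) (t : hom W Y) :
  copair f t \oc binl X W = f.
Proof.
by rewrite compmDl -!compmA binlK bprr_binl compm1 compm0 addr0.
Qed.

Lemma copair_binr X W Y (f : hom X Y) (t : hom W Y) :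
  copair f t \oc binr X W = t.
Proof.
by rewrite compmDl -!compmA binrK bprl_binr compm1 compm0 add0r.
Qed.

Lemma comp_copair X W Y Z (g : hom Y Z) (f : hom X Y) (t : hom W Y) :
  g \oc copair f t = copair (g \oc f) (g \oc t).
Proof. by rewrite /copair compmDr !compmA. Qed.

Lemma iso_id X : is_iso (idm X).
Proof. by exists (idm X); rewrite comp1m. Qed.

End Additive.

Section Bifunctor.
Variables (B : additive_category) (E : additive_bifunctor B).

Lemma push0 (C A A' : B) (d : E C A) : push E (0 : hom A A') d = 0.
Proof. by apply: (addrI (push E 0 d)); rewrite -pushD !addr0. Qed.

Lemma pull0 (C C' A : B) (d : E C A) : pull E (0 : hom C' C) d = 0.
Proof. by apply: (addrI (pull E 0 d)); rewrite -pullD !addr0. Qed.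

End Bifunctor.

Section Realization.
Variable B : extriangulated_category.
Implicit Types A C M : B.

Lemma real_ex A C (d : Ext C A) :
  exists (M : B) (x : hom A M) (y : hom M C), real d x y.
Proof.
have [ecv _ _ _] := exET2 B; have [M [x [y xyP]]] := ecv _ _ d.
exists M, x, y; apply/xyP; exists (idm M).
by split; [exact: iso_id|rewrite comp1m|rewrite compm1].
Qed.

Lemma real_iso A C (d : Ext C A) M M' (x : hom A M) (y : hom M C)
    (b : hom M M') (y' : hom M' C) :
  is_iso b -> y' \oc b = y -> real d x y -> real d (b \oc x) y'.
Proof.
move=> [b' [b'K bK]] yb.
have [ecv _ _ _] := exET2 B; have [M0 [x0 [y0 xyP]]] := ecv _ _ d.
move=> /xyP [c [[c' [c'K cK]] cx yc]]; apply/xyP; exists (b \oc c); split.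
- exists (c' \oc b'); split.
    by rewrite -compmA (compmA b') b'K comp1m.
  by rewrite -compmA (compmA c) cK comp1m.
- by rewrite -compmA cx.
- by rewrite compmA yb.
Qed.

Lemma real_equiv A C (d : Ext C A) M M' (x : hom A M) (y : hom M C)
    (x' : hom A M') (y' : hom M' C) :
  real d x y -> real d x' y' -> seq_equiv x y x' y'.
Proof.
have [ecv _ _ _] := exET2 B; have [M0 [x0 [y0 xyP]]] := ecv _ _ d.
move=> /xyP [c [[c' [c'K cK]] cx yc]] /xyP [e [[e' [e'K eK]] ex ye]].
exists (e \oc c'); split.
- exists (c \oc e'); split.
    by rewrite -compmA (compmA e') e'K comp1m.
  by rewrite -compmA (compmA c') c'K comp1m.
- by rewrite -cx -compmA (compmA c') c'K comp1m.
- by rewrite compmA ye -yc -compmA cK compm1.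
Qed.

(** The swap isomorphism carries the split conflation to its mirror image, which is the split axiom
    of the opposite category. *)
Lemma real0_swap A C : real (0 : Ext A C) (binr A C) (bprl A C).
Proof.
have [_ _ zrs _] := exET2 B.
rewrite -(copair_binl (binr A C) (binl A C)).
apply: real_iso (zrs C A).
  exists (copair (binr C A) (binl C A)).
  rewrite !comp_copair !copair_binl !copair_binr /copair.
  by rewrite !biprod_id.
by rewrite comp_copair binlK bprl_binr /copair comp0m comp1m add0r.
Qed.

End Realization.

(** * The opposite extriangulated category *)

Section Opposite.
Variable B : extriangulated_category.

(** Objects are kept and arrows reversed by explicit terms, so a statement about [op B] converts to
    its dual in [B] and dual lemmas follow at once. *)
Definition op_preadditive : preadditive_category :=
  @PreadditiveCategory B (fun X Y => hom Y X) (fun X => idm X)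
    (fun _ _ _ g f => f \oc g)
    (fun _ _ _ _ h g f => esym (compmA f g h))
    (fun _ _ f => compm1 f) (fun _ _ f => comp1m f)
    (fun _ _ _ g g' f => compmDr f g g') (fun _ _ _ g f f' => compmDl f f' g).

Definition op_additive : additive_category :=
  @AdditiveCategory op_preadditive (@zobj B)
    (@zobj_terminal B) (@zobj_initial B) (@biprod B)
    (@bprl B) (@bprr B) (@binl B) (@binr B)
    (@binlK B) (@binrK B) (@biprod_id B).

Definition op_Ext : additive_bifunctor op_additive :=
  @AdditiveBifunctor op_additive (fun C A => Ext A C)
    (fun C A A' a => @pull B Ext A A' C a)
    (fun C C' A c => @push B Ext A C C' c)
    (fun C A => @pull1 B Ext A C)
    (fun C A A' A'' a' a => @pull_comp B Ext A A' A'' C a a')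
    (fun C A A' => @pullD B Ext A A' C)
    (fun C A => @push1 B Ext A C)
    (fun C C' C'' A c c' => @push_comp B Ext A C C' C'' c' c)
    (fun C C' A => @pushD B Ext A C C')
    (fun C C' A A' a c d => esym (@push_pull B Ext A A' C C' c a d)).

Definition op_real : realization op_Ext :=
  fun A C d M x y => @real B C A d M y x.

Lemma op_ET2 : ET2 op_real.
Proof.
have [ecv mr zrs sr] := exET2 B; split.
- move=> A C d; have [M [x [y xyP]]] := ecv _ _ d.
  exists M, y, x => M' x' y'; split.
    move=> /xyP [b [[b' [b'K bK]] bx yb]]; exists b'; split.
    + by exists b.
    + by rewrite /= -yb -compmA bK compm1.
    + by rewrite /= -bx compmA b'K comp1m.
  move=> [b [[b' /= [b'K bK]] /= bx yb]]; apply/xyP; exists b'; split.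
  + by exists b.
  + by rewrite -yb compmA bK comp1m.
  + by rewrite -bx -compmA b'K compm1.
- move=> A M C A' M' C' d d' x y x' y' a c dxy dxy' /esym e.
  have [b [bx yb]] := mr _ _ _ _ _ _ _ _ _ _ _ _ _ _ dxy' dxy e.
  by exists b.
- by move=> A C; apply: real0_swap.
- move=> A M C A' M' C' d d' x y x' y' dxy dxy'.
  have := sr _ _ _ _ _ _ _ _ _ _ _ _ dxy dxy'.
  by rewrite /op_real /ext_sum /bimap /= -!compmA !push_pull.
Qed.

Lemma op_ET3 : ET3 op_real.
Proof.
move=> A M C A' M' C' d d' x y x' y' a b dxy dxy' e.
have [c [? ?]] := exET3op dxy' dxy (esym e).
by exists c.
Qed.

Lemma op_ET3op : ET3op op_real.
Proof.
move=> A M C A' M' C' d d' x y x' y' b c dxy dxy' e.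
have [a [? ?]] := exET3 dxy' dxy (esym e).
by exists a.
Qed.

Definition op : extriangulated_category :=
  @ExtriangulatedCategory op_additive op_Ext op_real
    op_ET2 op_ET3 op_ET3op (@exET4op B) (@exET4 B).

End Opposite.

(** * Exact sequences of a conflation *)

(** Comparing a conflation with [A = A -> 0], or dually [0 -> C = C], through ET2 and ET3 yields its
    exact sequences. *)
Lemma real_id (B : extriangulated_category) (A : B) :
  real (0 : Ext zobj A) (idm A) 0.
Proof.
have [_ _ zrs _] := exET2 B.
rewrite -(binlK A zobj); apply: real_iso (zrs A zobj).
  exists (binl A zobj); rewrite binlK; split=> //.
  by rewrite -[RHS]biprod_id (zobj_terminal (bprr _ _)) compm0 addr0.
exact: to_zobj.
Qed.

Lemma real_zobj_id (B : extriangulated_category) (C : B) :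
  real (0 : Ext C zobj) 0 (idm C).
Proof. exact: (@real_id (op B) C). Qed.

Section Real.
Variables (B : extriangulated_category) (A C M : B) (d : Ext C A).
Variables (x : hom A M) (y : hom M C).
Hypothesis dxy : real d x y.

Lemma real_comp0 : y \oc x = 0.
Proof.
have e : x \oc idm A = x \oc idm A by [].
have [c [cy _]] := exET3 (real_id A) dxy e.
by rewrite -cy compm0.
Qed.

Lemma factor_deflation Z (f : hom M Z) :
  f \oc x = 0 -> exists f' : hom C Z, f = f' \oc y.
Proof.
move=> fx; have e : f \oc x = 0 \oc (0 : hom A zobj) by rewrite fx compm0.
have [c [cy _]] := exET3 dxy (real_zobj_id Z) e.
by exists c; rewrite cy comp1m.
Qed.

Lemma push_inflation : push Ext x d = 0.
Proof.
have e : idm M \oc x = idm M \oc x by [].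
have [c [_ ->]] := exET3 dxy (real_id M) e.
exact: raddf0.
Qed.

(** The pair [(a, 0)] is a morphism from [d] to the zero class realized by [Z = Z -> 0]; ET2
    supplies the middle map. *)
Lemma push_eq0_extend Z (a : hom A Z) :
  push Ext a d = 0 -> exists b : hom M Z, a = b \oc x.
Proof.
move=> ad0; have [_ mr _ _] := exET2 B.
have e : push Ext a d = pull Ext (0 : hom C zobj) 0 by rewrite ad0 pull0.
have [b [bx _]] := mr _ _ _ _ _ _ _ _ _ _ _ _ _ _ dxy (real_id Z) e.
by exists b; rewrite bx comp1m.
Qed.

End Real.

Section RealDual.
Variables (B : extriangulated_category) (A C M : B) (d : Ext C A).
Variables (x : hom A M) (y : hom M C).
Hypothesis dxy : real d x y.

Lemma factor_inflation Z (f : hom Z M) :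
  y \oc f = 0 -> exists f' : hom Z A, f = x \oc f'.
Proof. exact: (@factor_deflation (op B) _ _ _ d y x dxy Z f). Qed.

Lemma pull_deflation : pull Ext y d = 0.
Proof. exact: (@push_inflation (op B) _ _ _ d y x dxy). Qed.

Lemma pull_eq0_lift Z (c : hom Z C) :
  pull Ext c d = 0 -> exists b : hom Z M, c = y \oc b.
Proof. exact: (@push_eq0_extend (op B) _ _ _ d y x dxy Z c). Qed.

(** Since [th] vanishes on [M], the map [y] lifts to the middle term realizing [th]; ET3op then
    turns the lift into a map of extensions over [C]. *)
Lemma pull_deflation_eq0 Z (th : Ext C Z) :
  pull Ext y th = 0 -> exists a : hom A Z, th = push Ext a d.
Proof.
move=> yth; have [N [x' [y' thxy]]] := real_ex th.
have [_ mr _ _] := exET2 B.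
have e : push Ext (0 : hom zobj Z) 0 = pull Ext y th by rewrite push0 yth.
have [g [_ yg]] := mr _ _ _ _ _ _ _ _ _ _ _ _ _ _ (real_zobj_id M) thxy e.
have [|a [_ ath]] := exET3op (b := g) (c := idm C) dxy thxy.
  by rewrite comp1m -yg compm1.
by exists a; rewrite ath pull1.
Qed.

End RealDual.

Lemma push_inflation_eq0 (B : extriangulated_category) (A C M : B)
    (d : Ext C A) (x : hom A M) (y : hom M C) Z (th : Ext Z A) :
  real d x y -> push Ext x th = 0 -> exists c : hom Z C, th = pull Ext c d.
Proof.
by move=> dxy; apply: (@pull_deflation_eq0 (op B) C A M d y x dxy Z th).
Qed.

Lemma real0_section (B : extriangulated_category) (A C M : B)
    (x : hom A M) (y : hom M C) :
  real (0 : Ext C A) x y -> exists s : hom C M, y \oc s = idm C.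
Proof.
move=> dxy; have [|s ->] := @pull_eq0_lift _ _ _ _ _ _ _ dxy C (idm C).
  exact: raddf0.
by exists s.
Qed.

Lemma real0_retraction (B : extriangulated_category) (A C M : B)
    (x : hom A M) (y : hom M C) :
  real (0 : Ext C A) x y -> exists r : hom M A, r \oc x = idm A.
Proof.
move=> dxy; have [|r ->] := @push_eq0_extend _ _ _ _ _ _ _ dxy A (idm A).
  exact: raddf0.
by exists r.
Qed.

(* ET4op splits [th] pulled back along the composite deflation; a retraction
   of the resulting split inflation carries the class on [C] that pulls back
   to [th]. *)
Lemma pull_inflation_eq0 (B : extriangulated_category) (A C M : B)
    (d : Ext C A) (x : hom A M) (y : hom M C) Z (th : Ext M Z) :
  real d x y -> pull Ext x th = 0 -> exists th' : Ext C Z, th = pull Ext y th'.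
Proof.
move=> dxy xth; have [N [x' [y' thxy]]] := real_ex th.
have [G [p [e [h [d3 [[_ _ _] [r0 _ yd3]]]]]]] := exET4op dxy thxy.
rewrite xth in r0.
have [r re] := real0_retraction r0.
exists (push Ext r d3).
by rewrite -push_pull yd3 -push_comp re push1.
Qed.

Lemma push_deflation_eq0 (B : extriangulated_category) (A C M : B)
    (d : Ext C A) (x : hom A M) (y : hom M C) Z (th : Ext Z M) :
  real d x y -> push Ext y th = 0 -> exists th' : Ext Z A, th = push Ext x th'.
Proof.
by move=> dxy; apply: (@pull_inflation_eq0 (op B) C A M d y x Z th dxy).
Qed.

(** * Deflations and retractions *)

Section Deflations.
Variable B : extriangulated_category.
Implicit Types A C M K X Y Z W : B.

Lemma real_conflation A C M (d : Ext C A) (x : hom A M) (y : hom M C) :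
  real d x y -> conflation x y.
Proof. by exists d. Qed.

Lemma deflation_comp A M D N F (f : hom M A) (f' : hom D M) (g : hom N M)
    (g' : hom F N) :
  conflation f' f -> conflation g' g ->
  exists (G : B) (h : hom G N), conflation h (f \oc g) /\
    exists (e : hom F G) (p : hom G D), conflation e p.
Proof.
move=> [d1 df] [d2 dg].
have [G [p [e [h [d3 [[_ _ r3] [rp _ _]]]]]]] := exET4op df dg.
exists G, h; split; first by exists d3.
by exists e, p; exists (pull Ext f' d2).
Qed.

Lemma inflation_comp A M D N F (f : hom A M) (f' : hom M D) (g : hom M N)
    (g' : hom N F) :
  conflation f f' -> conflation g g' ->
  exists (G : B) (h : hom N G), conflation (g \oc f) h /\
    exists (p : hom D G) (e : hom G F), conflation p e.
Proof.
move=> [d1 df] [d2 dg].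
have [G [p [e [h [d3 [[_ _ r3] [rp _ _]]]]]]] := exET4 df dg.
exists G, h; split; first by exists d3.
by exists p, e; exists (push Ext f' d2).
Qed.

(* [copair f p] is [id (+) p : A (+) P -> A (+) M] followed by the split
   epimorphism [copair f id]. *)
Lemma copair_deflation A K P M (x : hom K P) (p : hom P M) (f : hom A M) :
  conflation x p ->
  exists (L : B) (k : hom L (A :+: P)), conflation k (copair f p).
Proof.
move=> [d dxp]; have [_ _ zrs sr] := exET2 B.
have r1 := sr _ _ _ _ _ _ _ _ _ _ _ _ (real_zobj_id A) dxp.
have r2 : conflation (binl A M - binr A M \oc f) (copair f (idm M)).
  exists (0 : Ext M A).
  have -> : binl A M - binr A M \oc f =
      copair (binl A M - binr A M \oc f) (binr A M) \oc binl A M.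
    by rewrite copair_binl.
  apply: real_iso (zrs A M).
    exists (copair (binl A M + binr A M \oc f) (binr A M)).
    rewrite !comp_copair !compmDr !compmN !compmA !copair_binl !copair_binr.
    by rewrite addrK subrK /copair biprod_id.
  rewrite comp_copair compmBr !compmA copair_binl copair_binr comp1m subrr.
  by rewrite /copair comp0m comp1m add0r.
have [G [h [hc _]]] := deflation_comp r2 (real_conflation r1).
exists G, h; suff <- : copair f (idm M) \oc bimap (idm A) p = copair f p by [].
by rewrite compmDr !compmA copair_binl copair_binr comp1m compm1.
Qed.

(** The idempotent [idm X - s \oc r] is killed by [r], so it factors through the kernel [w]; the
    identities hold because [w] is monic. *)
Lemma retraction_complement :
  weakly_idempotent_complete B ->
  forall X Y (r : hom X Y) (s : hom Y X), r \oc s = idm Y ->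
  exists (W : B) (w : hom W X) (p : hom X W),
    [/\ r \oc w = 0, p \oc s = 0, p \oc w = idm W
      & s \oc r + w \oc p = idm X].
Proof.
move=> wic X Y r s rs.
have [|W [w [rw kerw]]] := wic X Y r; first by exists s.
have [|p [wp _]] := kerw X (idm X - s \oc r).
  by rewrite compmBr compm1 compmA rs comp1m subrr.
have winj Z (u v : hom Z W) : w \oc u = w \oc v -> u = v.
  move=> e; have [|t [_ tu]] := kerw Z (w \oc u).
    by rewrite compmA rw comp0m.
  by rewrite -(tu u) // -(tu v).
exists W, w, p; split=> //.
- apply: winj; rewrite compmA wp compmBl -compmA rs.
  by rewrite comp1m compm1 subrr compm0.
- apply: winj; rewrite compmA wp compmBl -compmA rw.
  by rewrite comp1m compm1 compm0 subr0.
- by rewrite wp addrC subrK.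
Qed.

Lemma iso_of_square0 X (f n : hom X X) :
  f = idm X + n -> n \oc n = 0 ->
  exists g : hom X X, g \oc f = idm X /\ f \oc g = idm X.
Proof.
move=> -> nn; exists (idm X - n).
rewrite !(compmDl, compmDr, compNm, compmN, compm1, comp1m) nn.
by rewrite subr0 oppr0 addr0 addrK subrK.
Qed.

Lemma iso_of_two_sided X Y (f : hom X Y) (g h : hom Y X) :
  g \oc f = idm X -> f \oc h = idm Y -> is_iso f.
Proof.
move=> gf fh; exists g; split=> //.
by rewrite -[g]compm1 -fh (compmA g) gf comp1m.
Qed.

(* If [s] splits [r] with complement [W], the section [W -> A'] lifts to the
   cocone, splitting off [W] from it.  The two composites of the comparison maps
   [phi] and [psi] differ from the identity by a map of square zero. *)
Lemma deflation_of_retraction K A' A C (k : hom K A') (r : hom A' A)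
    (f : hom A C) :
  weakly_idempotent_complete B -> is_retraction r -> conflation k (f \oc r) ->
  exists (K' : B) (k' : hom K' A) (m : hom K' K) (c : hom K K'),
    conflation k' f /\ c \oc m = idm K'.
Proof.
move=> wic [s rs] [th thk].
have [W [w [p [rw ps pw srwp]]]] := retraction_complement wic rs.
have [|i wi] := factor_inflation thk (f := w).
  by rewrite -compmA rw compm0.
have pki : (p \oc k) \oc i = idm W by rewrite -compmA -wi.
have [K' [m [c [pkm ci cm ipkmc]]]] := retraction_complement wic pki.
have rki : (r \oc k) \oc i = 0 by rewrite -compmA -wi.
(* As [push Ext k th] vanishes, only the summand [m \oc c] of the identity of [K] acts on [th]; thus
   [m] induces a morphism back to [th]. *)
have mcth : push Ext m (push Ext c th) = th.
  rewrite -[RHS]push1 -ipkmc pushD !push_comp.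
  by rewrite (push_inflation thk) !raddf0 add0r.
have [N [x [y thxy]]] := real_ex (push Ext c th).
have [_ mr _ _] := exET2 B.
have [|b [bk yb]] := mr _ _ _ _ _ _ _ _ _ _ _ _ c (idm C) thk thxy.
  by rewrite pull1.
have [|b' [b'x yb']] := mr _ _ _ _ _ _ _ _ _ _ _ _ m (idm C) thxy thk.
  by rewrite pull1.
rewrite !comp1m in yb yb'.
have kmsr : s \oc (r \oc k \oc m) = k \oc m.
  rewrite !compmA -[RHS]comp1m -srwp compmDl !compmA.
  by rewrite -(compmA w p) -(compmA w) pkm compm0 addr0.
pose phi := b \oc s; pose psi := r \oc b'.
have yphi : y \oc phi = f by rewrite /phi compmA -yb -compmA rs compm1.
have fpsi : f \oc psi = y by rewrite /psi compmA.
have phik : phi \oc (r \oc k \oc m) = x.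
  by rewrite /phi -compmA kmsr compmA bk -compmA cm compm1.
have psix : psi \oc x = r \oc k \oc m by rewrite /psi -compmA b'x compmA.
have [n1 En1] : exists n : hom N N, n = phi \oc psi - idm N by eexists.
have n1x : n1 \oc x = 0.
  by rewrite En1 compmBl -compmA psix phik comp1m subrr.
have yn1 : y \oc n1 = 0.
  by rewrite En1 compmBr compmA yphi fpsi compm1 subrr.
have [||g1 [g1phi _]] := @iso_of_square0 _ (phi \oc psi) n1.
- by rewrite En1 addrC subrK.
- have [u n1u] := factor_inflation thxy yn1.
  by rewrite {2}n1u compmA n1x comp0m.
have [n2 En2] : exists n : hom A A, n = psi \oc phi - idm A by eexists.
have n2k : n2 \oc (r \oc k) = 0.
  rewrite -[r \oc k]compm1 -ipkmc compmDr (compmA _ i) rki comp0m add0r.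
  rewrite (compmA _ m) compmA En2 compmBl -compmA phik psix comp1m subrr.
  by rewrite comp0m.
have fn2 : f \oc n2 = 0.
  by rewrite En2 compmBr compmA fpsi yphi compm1 subrr.
have [||g2 [_ psig2]] := @iso_of_square0 _ (psi \oc phi) n2.
- by rewrite En2 addrC subrK.
(* [n2 \oc r] kills [k], hence factors through [f \oc r], while [f] kills [n2]. *)
- have [|u nu] := factor_deflation thk (f := n2 \oc r).
    by rewrite -compmA.
  have -> : n2 \oc n2 = n2 \oc r \oc (s \oc n2).
    by rewrite -compmA (compmA r) rs comp1m.
  by rewrite nu -!compmA (compmA r) rs comp1m fn2 compm0.
exists K', (r \oc k \oc m), m, c; split=> //; exists (push Ext c th).
rewrite -psix; apply: real_iso thxy => //.
apply: (@iso_of_two_sided _ _ psi (g1 \oc phi) (phi \oc g2)).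
  by rewrite -compmA.
by rewrite compmA.
Qed.

End Deflations.

(** The projection onto the complement is a cokernel of the section. *)
Lemma op_weakly_idempotent_complete (B : extriangulated_category) :
  weakly_idempotent_complete B -> weakly_idempotent_complete (op B).
Proof.
move=> wic X Y r [s rs].
have sr : @compm B Y X Y s r = idm Y by exact: rs.
have [W [w [p [_ pr pw rswp]]]] := retraction_complement wic sr.
exists W, p; split=> // Z z zr; exists (@compm B W X Z z w); split.
  have /= e := congr1 (@compm B X X Z z) rswp.
  by rewrite compmDr compmA (zr : @compm B Y X Z z r = 0) comp0m add0r
    compmA compm1 in e.
by move=> u <-; rewrite /= -compmA pw compm1.
Qed.

Lemma inflation_of_section (B : extriangulated_category) (A M M' C : B)
    (f : hom A M) (s : hom M M') (r : hom M' M) (y : hom M' C) :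
  weakly_idempotent_complete B -> r \oc s = idm M -> conflation (s \oc f) y ->
  exists (C' : B) (y' : hom M C') (m : hom C C') (c : hom C' C),
    conflation f y' /\ m \oc c = idm C'.
Proof.
move=> wic rs cf.
apply: (@deflation_of_retraction (op B) C M' M A y s f) cf.
  exact: op_weakly_idempotent_complete.
by exists r.
Qed.

(* [copair g (g \oc f)] is a deflation and factors as [g] after the
   retraction [copair id f]. *)
Lemma deflation_of_comp (B : extriangulated_category) (A M C K : B)
    (f : hom A M) (g : hom M C) (x : hom K A) :
  weakly_idempotent_complete B -> conflation x (g \oc f) ->
  exists (L : B) (k : hom L M), conflation k g.
Proof.
move=> wic cgf; have [L [k ck]] := copair_deflation g cgf.
rewrite -[X in copair X _]compm1 -comp_copair in ck.
have [|L' [k' [_ [_ [ck' _]]]]] := deflation_of_retraction wic _ ck.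
  by exists (binl M A); rewrite copair_binl.
by exists L', k'.
Qed.

(** * Perpendicular classes and cotorsion pairs *)

Lemma left_perp_retract (B : extriangulated_category) (Y : set B) (A S : B)
    (i : hom S A) (r : hom A S) :
  r \oc i = idm S -> left_perp Y A -> left_perp Y S.
Proof.
move=> ri XA Z YZ d.
by rewrite -[d]pull1 -ri pull_comp (XA _ YZ (pull Ext r d)) raddf0.
Qed.

Lemma left_perp_extension (B : extriangulated_category) (Y : set B) (A M C : B)
    (x : hom A M) (y : hom M C) :
  conflation x y -> left_perp Y A -> left_perp Y C -> left_perp Y M.
Proof.
move=> [d dxy] XA XC Z YZ th.
have [th' ->] := pull_inflation_eq0 dxy (XA _ YZ (pull Ext x th)).
by rewrite (XC _ YZ th') raddf0.
Qed.

Lemma left_perp_zobj (B : extriangulated_category) (Y : set B) :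
  left_perp Y zobj.
Proof.
by move=> Z _ d; rewrite -[d]pull1 (from_zobj (idm zobj) 0) pull0.
Qed.

Lemma right_perp_retract (B : extriangulated_category) (X : set B) (A S : B)
    (i : hom S A) (r : hom A S) :
  r \oc i = idm S -> right_perp X A -> right_perp X S.
Proof. exact: (@left_perp_retract (op B) X A S r i). Qed.

Lemma right_perp_extension (B : extriangulated_category) (X : set B)
    (A M C : B) (x : hom A M) (y : hom M C) :
  conflation x y -> right_perp X A -> right_perp X C -> right_perp X M.
Proof.
by move=> cxy YA YC; apply: (@left_perp_extension (op B) X C M A y x cxy).
Qed.

Lemma right_perp_zobj (B : extriangulated_category) (X : set B) :
  right_perp X zobj.
Proof. exact: (@left_perp_zobj (op B)). Qed.

Lemma split_conflation (B : extriangulated_category) (A C : B) :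
  conflation (binl A C) (bprr A C).
Proof. by have [_ _ zrs _] := exET2 B; exists 0; apply: zrs. Qed.

(** Perpendicular classes contain zero and are closed under extensions and retracts, so every
    closure condition is automatic. *)
Lemma cotorsion_pair_perp (B : extriangulated_category) (X Y : set B) :
  right_perp X = Y -> left_perp Y = X -> cotorsion_pair X Y.
Proof.
move=> XY YX; split=> //.
- split; rewrite -YX; first exact: left_perp_zobj.
  by move=> A A'; apply: left_perp_extension; apply: split_conflation.
- split; rewrite -XY; first exact: right_perp_zobj.
  by move=> A A'; apply: right_perp_extension; apply: split_conflation.
- rewrite -YX => A A' [f [g [gf fg]]]; exact: left_perp_retract fg.
- rewrite -XY => A A' [f [g [gf fg]]]; exact: right_perp_retract fg.
- rewrite -YX => A S S' [f [g [gf fg]]].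
  apply: (@left_perp_retract _ _ _ _ (g \oc binl S S') (bprl S S' \oc f)).
  by rewrite -compmA (compmA f) fg comp1m binlK.
- rewrite -XY => A S S' [f [g [gf fg]]].
  apply: (@right_perp_retract _ _ _ _ (g \oc binl S S') (bprl S S' \oc f)).
  by rewrite -compmA (compmA f) fg comp1m binlK.
Qed.

(** * Bijectivity modulo a subcategory *)

Section StableEquivalences.
Variables (B : extriangulated_category) (X W : set B).

Definition factors_through (A C : B) (f : hom A C) : Prop :=
  exists (D : B) (u : hom A D) (v : hom D C), W D /\ f = v \oc u.

(* [f] induces bijections [Hom(P, A) / W -> Hom(P, C) / W] for all [P] in [X],
   where [/ W] is the quotient by the morphisms factoring through [W]. *)
Definition stable_equiv (A C : B) (f : hom A C) : Prop :=
  forall P : B, X P ->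
    (forall b : hom P C, exists a : hom P A, factors_through (b - f \oc a)) /\
    (forall a : hom P A, factors_through (f \oc a) -> factors_through a).

Lemma factors_through_compl A C D (g : hom C D) (f : hom A C) :
  factors_through f -> factors_through (g \oc f).
Proof.
by move=> [V [u [v [WV ->]]]]; exists V, u, (g \oc v); rewrite compmA.
Qed.

Hypothesis Wadd : additive_subcategory W.

Lemma factors_throughD A C (f g : hom A C) :
  factors_through f -> factors_through g -> factors_through (f + g).
Proof.
move=> [V [u [v [WV ->]]]] [V' [u' [v' [WV' ->]]]].
exists (V :+: V'), (binl V V' \oc u + binr V V' \oc u'), (copair v v').
split; first exact: (proj2 Wadd).
by rewrite compmDr !compmA copair_binl copair_binr.
Qed.

Lemma factors_throughN A C (f : hom A C) :
  factors_through f -> factors_through (- f).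
Proof.
by move=> [V [u [v [WV ->]]]]; exists V, u, (- v); rewrite compNm.
Qed.

Lemma factors_throughBr A C (f g : hom A C) :
  factors_through g -> factors_through (f - g) -> factors_through f.
Proof. by move=> Wg Wfg; rewrite -(subrK g f); apply: factors_throughD. Qed.

Lemma factors_throughBl A C (f g : hom A C) :
  factors_through f -> factors_through (f - g) -> factors_through g.
Proof.
move=> Wf /factors_throughN; rewrite opprB; exact: factors_throughBr.
Qed.

Lemma stable_equiv_2of3 : two_out_of_three stable_equiv.
Proof.
move=> A C D f g; split=> eq1 eq2 P XP.
- have [surf injf] := eq1 P XP; have [surg injg] := eq2 P XP; split.
    move=> b; have [a1 Wa1] := surg b; have [a Wa] := surf a1; exists a.
    have := factors_throughD Wa1 (factors_through_compl g Wa).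
    by rewrite compmBr compmA addrA subrK.
  by move=> a; rewrite -compmA => /injg/injf.
- have [surf injf] := eq1 P XP; have [surg injg] := eq2 P XP; split.
    by move=> b; have [a] := surg b; rewrite -compmA; exists (f \oc a).
  (* Modulo [W], [a] is [f \oc a'], so injectivity for the composite applies to [a']. *)
  move=> a Wga; have [a' Wa'] := surf a.
  apply: (factors_throughBr _ Wa'); apply/factors_through_compl/injg.
  have := factors_through_compl g Wa'.
  by rewrite compmBr compmA; apply: factors_throughBl.
- have [surg injg] := eq1 P XP; have [surgf injgf] := eq2 P XP; split.
    move=> b; have [a Wa] := surgf (g \oc b); exists a; apply: injg.
    by rewrite compmBr compmA.
  move=> a Wfa; apply: injgf; rewrite -compmA; exact: factors_through_compl.
Qed.

Lemma stable_equiv_retract : retract_closed stable_equiv.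
Proof.
move=> A C A' C' f g [i [r [j [q [ri qj gijf frqg]]]]] eqg P XP.
have [sur inj] := eqg P XP; split.
  move=> b; have [a Wa] := sur (j \oc b); exists (r \oc a).
  have := factors_through_compl q Wa.
  by rewrite compmBr !compmA qj comp1m frqg.
move=> a Wfa; rewrite -[a]comp1m -ri -compmA; apply: factors_through_compl.
by apply: inj; rewrite compmA gijf -compmA; apply: factors_through_compl.
Qed.

End StableEquivalences.

(** * The model structure of a cotorsion pair *)

(** [M] splits as [A] plus [C]: use [u] on the first part and lift the remaining error, a map out of
    [C], along [p]. *)
Lemma split_lift (B : extriangulated_category) (W : set B) (A M C P Q : B)
    (i : hom A M) (y : hom M C) (p : hom P Q) (u : hom A P) (v : hom M Q) :
  real (0 : Ext C A) i y -> W C -> Fib_ W p -> p \oc u = v \oc i ->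
  exists h : hom M P, h \oc i = u /\ p \oc h = v.
Proof.
move=> di WC fp pu; have [r ri] := real0_retraction di.
have [|w vE] := factor_deflation di (f := v - p \oc (u \oc r)).
  by rewrite compmBl -!compmA ri compm1 pu subrr.
have [w' pw'] := fp _ WC w.
exists (u \oc r + w' \oc y); split.
  by rewrite compmDl -!compmA ri (real_comp0 di) compm0 addr0 compm1.
by rewrite compmDr (compmA p w') pw' -vE addrC subrK.
Qed.

(* The middle term [Z] realizes the sum of the pullbacks of the two given
   extensions to [C (+) D]; the fibre over each summand is one of them, up to
   isomorphism. *)
Lemma pushout_conflations (B : extriangulated_category) (K M C N D : B)
    (x : hom K M) (y : hom M C) (x' : hom K N) (y' : hom N D) :
  conflation x y -> conflation x' y' ->
  exists (Z M' N' : B) (b : hom M M') (j : hom M' Z) (z : hom Z D)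
      (n : hom N' Z) (q : hom Z C),
    [/\ is_iso b, isomorphic N N', conflation j z, conflation n q
      & q \oc j \oc b = y].
Proof.
move=> [d dx] [d' dx'].
pose mu := pull Ext (bprl C D) d + pull Ext (bprr C D) d'.
have [Z [k [g muk]]] := real_ex mu.
have mul : pull Ext (binl C D) mu = d.
  rewrite raddfD -!pull_comp binlK bprr_binl pull0 pull1; exact: addr0.
have mur : pull Ext (binr C D) mu = d'.
  rewrite raddfD -!pull_comp binrK bprl_binr pull0 pull1; exact: add0r.
have [_ _ zrs _] := exET2 B.
(* ET4op along each projection of [C :+: D] restricts [mu] to the other summand. *)
have [N' [p [e [n [d3 [[_ _ r3] [rp _ _]]]]]]] := exET4op (real0_swap C D) muk.
have [M' [p' [e' [j [d4 [[gj _ r4] [rp' _ _]]]]]]] := exET4op (zrs C D) muk.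
rewrite mur in rp; rewrite mul in rp'.
have [b [isob _ pb]] := real_equiv dx rp'.
have [c [isoc _ _]] := real_equiv dx' rp.
exists Z, M', N', b, j, (bprr C D \oc g), n, (bprl C D \oc g); split=> //.
- by exists c.
- exact: real_conflation r4.
- exact: real_conflation r3.
- by rewrite -(compmA _ g) gj compmA binlK comp1m.
Qed.

Section CotorsionToModel.
Variables (B : extriangulated_category).
Hypothesis wic : weakly_idempotent_complete B.
Variables (X Y : set B).
Hypothesis omXY : Omega B (X, Y).
Let W := (X `&` Y)%classic.

Let perpX : right_perp X = Y.
Proof. by case: omXY => -[]. Qed.

Let perpY : left_perp Y = X.
Proof. by case: omXY => -[]. Qed.

Let hered : hereditary X Y.
Proof. by case: omXY. Qed.

Let Wcf : contravariantly_finite W.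
Proof. by case: omXY. Qed.

Let cplt : complete X Y.
Proof. by case: omXY. Qed.

Lemma cotorsion_ext0 P Q (d : Ext P Q) : X P -> Y Q -> d = 0.
Proof. by rewrite -perpX => XP; apply. Qed.

Lemma cotorsion_core_additive : additive_subcategory W.
Proof.
case: omXY => /= -[[X0 XD] [Y0 YD]] _ _ _ _ _ _ _ _ _; split=> //.
by move=> A A' [XA YA] [XA' YA']; split; [apply: XD|apply: YD].
Qed.

Let stable := stable_equiv X W.

(** Embed [P] in [V] of [Y] with cone in [X]: then [V] is in [W], and [f] extends to [V] by
    orthogonality. *)
Lemma cotorsion_factors P Q (f : hom P Q) :
  X P -> Y Q -> factors_through W f.
Proof.
move=> XP YQ; have [_ [V [X' [x [y [[d dxy] XX' YV]]]]]] := cplt P.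
have [|b ->] := push_eq0_extend dxy (a := f).
  exact: cotorsion_ext0.
exists V, x, b; split=> //; split=> //; rewrite -perpY.
by apply: (left_perp_extension (real_conflation dxy)); rewrite perpY.
Qed.

(** Maps from [X] lift along [copair f t], and two lifts differ by a map through its cocone in [Y],
    hence through [W]. *)
Lemma Weq_stable A C (f : hom A C) : Weq_ W Y f -> stable f.
Proof.
move=> [V [t [WV [K [k [[d dk] YK]]]]]] P XP.
have liftP D (b : hom D C) : X D -> exists b', b = copair f t \oc b'.
  by move=> XD; apply: (pull_eq0_lift dk); apply: cotorsion_ext0.
split.
  move=> b; have [b' ->] := liftP _ b XP.
  exists (bprl A V \oc b'); exists V, (bprr A V \oc b'), t; split=> //.
  by rewrite /copair compmDl !compmA addrC addKr.
move=> a [D [u [v [[XD YD] fa]]]]; have [v' vE] := liftP _ v XD.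
have [|ka kaE] := factor_inflation dk (f := binl A V \oc a - v' \oc u).
  by rewrite compmBr !compmA copair_binl -vE fa subrr.
have WA := cotorsion_core_additive.
have -> : a = bprl A V \oc (binl A V \oc a) by rewrite compmA binlK comp1m.
apply: factors_through_compl.
apply: (factors_throughBr WA (g := v' \oc u)); first by exists D, u, v'.
by rewrite kaE; apply: factors_through_compl; apply: cotorsion_factors.
Qed.

Lemma stable_Weq A C (f : hom A C) : stable f -> Weq_ W Y f.
Proof.
move=> stf; have [V [t [WV tapp]]] := Wcf C.
exists V, t; split=> //.
have surP P (b : hom P C) : X P -> exists b', b = copair f t \oc b'.
  move=> XP; have [a [D [u [v [WD bfa]]]]] := (stf P XP).1 b.
  have [v' vE] := tapp _ v WD.
  exists (binl A V \oc a + binr A V \oc (v' \oc u)).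
  rewrite compmDr !compmA copair_binl copair_binr -vE -bfa addrC subrK //.
have [[KC [XC [xC [y [cy XXC _]]]]] _] := cplt C.
have [b' yE] := surP _ y XXC.
(* The deflation [y] factors through [copair f t], which is therefore a deflation. *)
have [K [k [d dk]]] : exists K (k : hom K _), conflation k (copair f t).
  by apply: (@deflation_of_comp _ _ _ _ _ b' _ xC) => //; rewrite -yE.
exists K, k; split; first by exists d.
rewrite -perpX => P XP th.
have [N [xN [yN thN]]] := real_ex th.
have [[YN [XN [xx [yy [cN XXN YYN]]]]] _] := cplt N.
have [G [h [cG _]]] := deflation_comp (real_conflation thN) cN.
have XG := (hered cG).1 XXN XP.
have [th' dG] := cG.
have [|a [ahE ath]] := exET3op (b := yy) (c := idm P) dG thN.
  by rewrite comp1m.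
rewrite pull1 in ath.
have [D [u [v [WD kaE]]]] : factors_through W (k \oc a).
  have WA := cotorsion_core_additive.
  rewrite -[k \oc a]comp1m -(biprod_id A V) compmDl.
  apply: factors_throughD => //; last first.
    exists V, (bprr A V \oc k \oc a), (binr A V); split=> //.
    by rewrite !compmA.
  (* After [f], the first component of [k \oc a] is minus [t] after the second, so it factors
     through [W]; stability of [f] cancels [f]. *)
  rewrite -compmA; apply: factors_through_compl; apply: (stf G XG).2.
  exists V, (- (bprr A V \oc (k \oc a))), t; split=> //.
  have := real_comp0 dk; rewrite compmN => /(congr1 (fun z => z \oc a)).
  rewrite comp0m compmDl compmDl -!compmA => /eqP.
  by rewrite addr_eq0 => /eqP.
(* Orthogonality of [P] and [D] extends [u] over [XN], so [u] kills the class of [G]. *)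
have [|w uE] := push_eq0_extend dG (a := u).
  by apply: cotorsion_ext0 => //; case: WD.
have kth : push Ext k th = 0.
  rewrite -ath -push_comp kaE uE !push_comp (push_inflation dG).
  by rewrite !raddf0.
have [c ->] := push_inflation_eq0 dk kth.
have [c' ->] := surP _ c XP.
by rewrite pull_comp (pull_deflation dk) raddf0.
Qed.

Lemma Weq_stableE : Weq_ W Y = stable.
Proof.
do 2!apply: functional_extensionality_dep => ?.
apply: functional_extensionality_dep => f; apply: propext.
by split; [apply: Weq_stable|apply: stable_Weq].
Qed.

Lemma deflation_Weq A C (f : hom A C) :
  deflation_with_cocone Y f -> Weq_ W Y f.
Proof.
move=> [K [k [[d dk] YK]]]; exists zobj, 0; split.
  exact: (proj1 cotorsion_core_additive).
exists K, (binl A zobj \oc k); split=> //; exists d.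
apply: real_iso dk; last exact: copair_binl.
exists (bprl A zobj); rewrite binlK; split=> //.
by rewrite -[RHS]biprod_id (zobj_terminal (bprr _ _)) compm0 addr0.
Qed.

Lemma triv_fib_deflation A C (f : hom A C) :
  (Fib_ W f /\ Weq_ W Y f) <-> deflation_with_cocone Y f.
Proof.
split=> [[fibf [V [t [WV [K [k [ck YK]]]]]]] | df].
  have [u tE] := fibf _ WV t.
  have fE : copair f t = f \oc copair (idm A) u.
    by rewrite comp_copair compm1 tE.
  rewrite fE in ck.
  have [|K' [k' [m [c [ck' cm]]]]] := deflation_of_retraction wic _ ck.
    by exists (binl A V); rewrite copair_binl.
  exists K', k'; split=> //; rewrite -perpX.
  by apply: right_perp_retract cm _; rewrite perpX.
split; last exact: deflation_Weq.
have [K [k [[d dk] YK]]] := df => V WV g.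
have [|h ->] := pull_eq0_lift dk (c := g); last by exists h.
by apply: cotorsion_ext0 => //; case: WV.
Qed.

(** A retraction of [f] is an inverse modulo [W], the error factoring through [C]. *)
Lemma split_stable A M C (f : hom A M) (y : hom M C) :
  real (0 : Ext C A) f y -> W C -> stable f.
Proof.
move=> df WC P XP; have [r rf] := real0_retraction df.
have [|s sE] := factor_deflation df (f := idm M - f \oc r).
  by rewrite compmBl -compmA rf comp1m compm1 subrr.
split=> [b|a].
  exists (r \oc b), C, (y \oc b), s; split=> //.
  by rewrite !compmA -sE compmBl comp1m.
by move=> /(factors_through_compl r); rewrite compmA rf comp1m.
Qed.

(** Pushed to [A :+: V], the class [d] dies under [copair f t], so it comes from the cocone, where
    orthogonality kills it; hence [d] itself is zero. *)
Lemma triv_cofib_split A M (f : hom A M) :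
  (inflation_with_cone X f /\ Weq_ W Y f) <->
  exists (C : B) (y : hom M C), real (0 : Ext C A) f y /\ W C.
Proof.
split; last first.
  move=> [C [y [df WC]]]; split; last exact/stable_Weq/(split_stable df).
  by exists C, y; split; [exists 0|case: WC].
move=> [[C [y [[d df] XC]]] [V [t [WV [K [k [[e ek] YK]]]]]]].
have d0 : d = 0.
  have [|th inE] := push_deflation_eq0 ek (th := push Ext (binl A V) d).
    by rewrite -push_comp copair_binl (push_inflation df).
  rewrite -[d]push1 -(binlK A V) push_comp inE.
  by rewrite (cotorsion_ext0 th XC YK) !raddf0.
rewrite d0 in df; exists C, y; split=> //; split=> //.
(* Lifting a section of [y] along [copair f t] exhibits [C] as a retract of [V]. *)
have [s ys] := real0_section df.
have [|s' sE] := pull_eq0_lift ek (c := s); first exact: cotorsion_ext0.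
rewrite -perpX; apply: (right_perp_retract (A := V)
  (i := bprr A V \oc s') (r := y \oc t)); last by rewrite perpX; case: WV.
rewrite -ys sE /copair !compmDl compmDr !compmA (real_comp0 df).
by rewrite !comp0m add0r.
Qed.

Lemma cotorsion_fact_fib :
  factorization (triv_cofib (Phi (X, Y))) (fib (Phi (X, Y))).
Proof.
move=> A C f; have [V [t [WV tapp]]] := Wcf C.
(* The approximation [t] makes [copair f t] surjective on maps from [W]. *)
exists (A :+: V), (binl A V), (copair f t); split.
- apply/triv_cofib_split; exists V, (bprr A V); split=> //.
  by have [_ _ zrs _] := exET2 B; apply: zrs.
- move=> D WD g; have [u ->] := tapp _ g WD.
  by exists (binr A V \oc u); rewrite compmA copair_binr.
- by rewrite copair_binl.
Qed.

(** Adding a cover [P] of [C] makes [f] a deflation; pushing out along an embedding of its cocone in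
    [Y] moves that cocone into [Y]. The cone of the resulting inflation is an extension of [D] by
    [P]. *)
Lemma cotorsion_fact_triv_fib :
  factorization (cofib (Phi (X, Y))) (triv_fib (Phi (X, Y))).
Proof.
move=> A C f; have [[L [P [l [p [cp XP _]]]]] _] := cplt C.
have [K [k ck]] := copair_deflation f cp.
have [_ [N [D [n [m [cn XD YN]]]]]] := cplt K.
have [Z [M' [N' [b [j [z [n' [q [isob isoN cj cq qjb]]]]]]]]] :=
  pushout_conflations ck cn.
have [b' [b'b _]] := isob.
have cA : conflation (b \oc binl A P) (bprr A P \oc b').
  have [_ _ zrs _] := exET2 B; exists 0; apply: real_iso (zrs A P) => //.
  by rewrite -compmA b'b compm1.
have [G [h [cG [u [v cu]]]]] := inflation_comp cA cj.
exists Z, (j \oc (b \oc binl A P)), q; split.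
- exists G, h; split=> //; rewrite -perpY.
  by apply: (left_perp_extension cu); rewrite perpY.
- apply/triv_fib_deflation; exists N', n'; split=> //.
  by case: omXY => -[_ _ _ isoY _ _ _ _] _ _ _; apply: isoY YN.
- by rewrite !compmA qjb copair_binl.
Qed.

(** Vanishing of E(C, K) is used twice: it extends [u] over [M], then lifts along [p] the error in
    the lower triangle, a map out of [C]. *)
Lemma cotorsion_lift_triv_fib :
  lifting (cofib (Phi (X, Y))) (triv_fib (Phi (X, Y))).
Proof.
move=> A M P Q i p u v [C [y [[d di] XC]]] /triv_fib_deflation.
move=> [K [k [[e ek] YK]]] pu.
have [|th uE] := push_deflation_eq0 ek (th := push Ext u d).
  by rewrite -push_comp pu push_comp (push_inflation di) raddf0.
rewrite (cotorsion_ext0 th XC YK) raddf0 in uE.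
have [h hi] := push_eq0_extend di uE.
have [|w vE] := factor_deflation di (f := v - p \oc h).
  by rewrite compmBl -compmA -hi pu subrr.
have [|w' wE] := pull_eq0_lift ek (c := w); first exact: cotorsion_ext0.
exists (h + w' \oc y); split.
  by rewrite compmDl -compmA (real_comp0 di) compm0 addr0.
by rewrite compmDr compmA -wE -vE addrC subrK.
Qed.

(* Factoring [f] as a trivial fibration [q] after a cofibration [j], the lifting
   property makes [j = s \oc f] with [s] a section of [q]. *)
Lemma cotorsion_cofib_retract : retract_closed (cofib (Phi (X, Y))).
Proof.
move=> A M A' M' f g [i [r [j [t [ri tj gi fr]]]]] cofg.
have [Z [l [q [[C [y [cl XC]]] tfq fE]]]] := cotorsion_fact_triv_fib f.
have [|h [hg qh]] :=
  cotorsion_lift_triv_fib (u := l \oc r) (v := t) cofg tfq.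
  by rewrite compmA -fE fr.
have lE : l = h \oc j \oc f.
  by rewrite -compmA -gi compmA hg -compmA ri compm1.
rewrite lE in cl.
have qhj : q \oc (h \oc j) = idm M by rewrite compmA qh tj.
have [C' [y' [m [c [cf mc]]]]] := inflation_of_section wic qhj cl.
exists C', y'; split=> //; rewrite -perpY.
by apply: left_perp_retract mc _; rewrite perpY.
Qed.

Lemma Fib_retract (V : set B) : retract_closed (Fib_ V).
Proof.
move=> A M A' M' f g [i [r [j [t [ri tj gi fr]]]]] fibg D VD b.
have [h gh] := fibg D VD (j \oc b).
by exists (r \oc h); rewrite compmA fr -compmA gh compmA tj comp1m.
Qed.

Lemma Phi_model_structure : model_structure (Phi (X, Y)).
Proof.
have WE : @weq B (Phi (X, Y)) = stable by apply: Weq_stableE.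
split.
- rewrite WE; apply: stable_equiv_2of3; exact: cotorsion_core_additive.
- exact: cotorsion_cofib_retract.
- exact: Fib_retract.
- rewrite WE; exact: stable_equiv_retract.
- exact: cotorsion_lift_triv_fib.
- move=> A M P Q i p u v /triv_cofib_split [C [y [di WC]]] fp.
  exact: split_lift di WC fp.
- exact: cotorsion_fact_fib.
- exact: cotorsion_fact_triv_fib.
Qed.

Lemma cofibrant_Phi : cofibrant (Phi (X, Y)) = X.
Proof.
apply/seteqP; split=> P.
  move=> [C [y [cy XC]]]; rewrite -perpY; apply: (left_perp_extension cy).
    exact: left_perp_zobj.
  by rewrite perpY.
by move=> XP; exists P, (idm P); split=> //; exists 0; apply: real_zobj_id.
Qed.

Lemma triv_fibrant_Phi : triv_fibrant (Phi (X, Y)) = Y.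
Proof.
apply/seteqP; split=> P.
  move=> [[V [t [[_ YV] [K [k [ck YK]]]]]] _].
  (* The middle term [zobj :+: V] is in [Y]. *)
  apply: (hered ck).2 => //.
  have [_ [Y0 YD] _ _ _ _ _ _] : cotorsion_pair X Y by case: omXY.
  exact: YD.
move=> YP; split; last first.
  by move=> D _ g; exists 0; apply: to_zobj.
apply: stable_Weq => Q XQ; split=> [b|a _].
  exists 0; rewrite comp0m subr0; exact: cotorsion_factors.
exists zobj, a, (idm zobj); split; last by rewrite comp1m.
exact: (proj1 cotorsion_core_additive).
Qed.

Lemma Psi_Phi : Psi (Phi (X, Y)) = (X, Y).
Proof. by rewrite /Psi cofibrant_Phi triv_fibrant_Phi. Qed.

Lemma Phi_Gamma : Gamma B (Phi (X, Y)).
Proof.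
split; first exact: Phi_model_structure.
split; rewrite ?cofibrant_Phi ?triv_fibrant_Phi //.
  by move=> A M f; apply: triv_fib_deflation.
by move=> A; exact: (fun D _ g => ex_intro _ 0 (to_zobj _ _)).
Qed.

End CotorsionToModel.

(** * The cotorsion pair of a model structure *)

Section ModelToCotorsion.
Variables (B : extriangulated_category).
Hypothesis wic : weakly_idempotent_complete B.
Variable T : mor_triple B.
Hypothesis gT : Gamma B T.
Let X := cofibrant T.
Let Y := triv_fibrant T.
Let W := (X `&` Y)%classic.

Let mT : model_structure T := proj1 gT.
Let wT : weakly_projective T := proj2 gT.

(** Factoring the identity as [p \oc i] makes it a retract of the trivial cofibration [i]. *)
Lemma weq_id (A : B) : weq T (idm A).
Proof.
have [Z [i [p [[_ wi] _ pi]]]] := model_fact_triv_cofib mT (idm A).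
apply: (model_weq_retract mT) wi.
by exists (idm A), (idm A), i, p; rewrite !compm1.
Qed.

Lemma triv_fibrantE (A : B) : Y A <-> weq T (0 : hom zobj A).
Proof.
by split=> [[]//|wA]; split=> //; apply: (wproj_fibrant wT).
Qed.

Lemma cofibrant_retract (P S : B) (i : hom S P) (r : hom P S) :
  r \oc i = idm S -> X P -> X S.
Proof.
move=> ri XP; apply: (model_cofib_retract mT) XP.
by exists 0, 0, i, r; split=> //; exact: from_zobj.
Qed.

Lemma triv_fibrant_retract (P S : B) (i : hom S P) (r : hom P S) :
  r \oc i = idm S -> Y P -> Y S.
Proof.
move=> ri /triv_fibrantE wP; apply/triv_fibrantE.
apply: (model_weq_retract mT) wP.
by exists 0, 0, i, r; split=> //; exact: from_zobj.
Qed.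

Lemma conflation_to_cofibrant (A : B) :
  exists (K P : B) (x : hom K P) (y : hom P A), [/\ conflation x y, X P & Y K].
Proof.
have [P [i [p [ci tp _]]]] := model_fact_triv_fib mT (0 : hom zobj A).
have [K [x [cx YK]]] := (wproj_triv_fib wT p).1 tp.
exists K, P, x, p; split=> //.
by rewrite /X /cofibrant /= (from_zobj 0 i).
Qed.

Lemma conflation_from_triv_fibrant (A : B) :
  exists (N C : B) (x : hom A N) (y : hom N C), [/\ conflation x y, X C & Y N].
Proof.
have [N [i [p [ci [_ wp] _]]]] := model_fact_triv_fib mT (0 : hom A zobj).
have [C [y [cy XC]]] := (wproj_cofib wT i).1 ci.
exists N, C, i, y; split=> //; apply/triv_fibrantE.
(* Composing [0 -> N] with the weak equivalence [p] gives the identity of zero. *)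
have [_ _ ax] := model_weq_2of3 mT (0 : hom zobj N) p.
by apply: ax wp _; rewrite (from_zobj (p \oc 0) (idm zobj)); apply: weq_id.
Qed.

Lemma cofibrant_orthogonal (P Q : B) (d : Ext P Q) : X P -> Y Q -> d = 0.
Proof.
move=> XP YQ; have [M [x [y dxy]]] := real_ex d.
have tfy : triv_fib T y.
  by apply/(wproj_triv_fib wT); exists Q, x; split=> //; exists d.
(* A lift of the identity of [P] along [y] is a section, which splits [d]. *)
have [|s [_ ys]] := model_lift_cofib mT (u := 0) (v := idm P) XP tfy.
  exact: from_zobj.
by rewrite -[d]pull1 -ys pull_comp (pull_deflation dxy) raddf0.
Qed.

Lemma right_perp_cofibrant : right_perp X = Y.
Proof.
apply/seteqP; split=> Q; last by move=> YQ P XP d; apply: cofibrant_orthogonal.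
move=> oQ.
have [N [C [x [y [[d dxy] XC YN]]]]] := conflation_from_triv_fibrant Q.
rewrite (oQ _ XC d) in dxy; have [r rx] := real0_retraction dxy.
exact: triv_fibrant_retract rx YN.
Qed.

Lemma left_perp_triv_fibrant : left_perp Y = X.
Proof.
apply/seteqP; split=> P; last by move=> XP Q YQ d; apply: cofibrant_orthogonal.
move=> oP; have [K [M [x [y [[d dxy] XM YK]]]]] := conflation_to_cofibrant P.
rewrite (oP _ YK d) in dxy; have [s ys] := real0_section dxy.
exact: cofibrant_retract ys XM.
Qed.

Lemma triv_fibrant_cone (A M C : B) (x : hom A M) (y : hom M C) :
  conflation x y -> Y A -> Y M -> Y C.
Proof.
move=> cxy YA /triv_fibrantE wM; apply/triv_fibrantE.
have [_ wy] : triv_fib T y by apply/(wproj_triv_fib wT); exists A, x.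
have [ax _ _] := model_weq_2of3 mT (0 : hom zobj M) y.
by have := ax wM wy; rewrite compm0.
Qed.

(* For [th] in [E(A, Q)], the inclusion of [Q] into a trivially fibrant object
   containing a realization of [th] has a trivially fibrant cone [G], and [th]
   is pulled back from [G] along a map [A -> G] which extends to [M]. *)
Lemma cofibrant_cocone (A M C : B) (x : hom A M) (y : hom M C) :
  conflation x y -> X M -> X C -> X A.
Proof.
move=> [d dxy] XM XC; rewrite -left_perp_triv_fibrant => Q YQ th.
have [N [x' [y' thN]]] := real_ex th.
have [N' [C' [n [m [cn XC' YN']]]]] := conflation_from_triv_fibrant N.
have [G [h [cG _]]] := inflation_comp (real_conflation thN) cn.
have YG := triv_fibrant_cone cG YQ YN'.
have [th' dG] := cG.
have [|a [_ ath]] := exET3 (a := idm Q) (b := n) thN dG.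
  by rewrite compm1.
have [|b aE] := push_eq0_extend dxy (a := a); first exact: cofibrant_orthogonal.
rewrite -[th]push1 ath aE pull_comp.
by rewrite (cofibrant_orthogonal (pull Ext b th') XM YQ) raddf0.
Qed.

(** This turns lifting and factorization of trivial cofibrations out of zero into statements about
    [W]. *)
Lemma core_triv_cofib (P : B) : W P <-> triv_cofib T (0 : hom zobj P).
Proof. by split=> -[XP /triv_fibrantE YP]. Qed.

Lemma fib_Fib (A C : B) (f : hom A C) : fib T f -> Fib_ W f.
Proof.
move=> ff V /core_triv_cofib tV g.
have [|h [_ fh]] := model_lift_triv_cofib mT (u := 0) (v := g) tV ff.
  exact: from_zobj.
by exists h.
Qed.

Lemma Psi_Omega : Omega B (Psi T).
Proof.
split => /=.
- apply: cotorsion_pair_perp; first exact: right_perp_cofibrant.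
  exact: left_perp_triv_fibrant.
- move=> C; split; first exact: conflation_to_cofibrant.
  have [N [D [x [y [cxy XD YN]]]]] := conflation_from_triv_fibrant C.
  by exists N, D, x, y.
- move=> A M C x y cxy; split; first exact: cofibrant_cocone cxy.
  exact: triv_fibrant_cone cxy.
(* Factoring [0 -> C] as a trivial cofibration followed by a fibration gives the approximation
   [p]. *)
- move=> C; have [V [i [p [ti fp _]]]] :=
    model_fact_triv_cofib mT (0 : hom zobj C).
  exists V, p; split.
    by apply/core_triv_cofib; rewrite (from_zobj 0 i).
  move=> V' t WV'; have [u tE] := fib_Fib fp WV' t.
  by exists u.
Qed.

(* Every object being fibrant, a trivial cofibration is a section, and its
   cone is a retract of it. *)
Lemma triv_cofib_real0 (A M : B) (f : hom A M) : triv_cofib T f ->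
  exists (C : B) (y : hom M C), real (0 : Ext C A) f y /\ W C.
Proof.
move=> tf; have [cf wf] := tf.
have [C [y [[d df] XC]]] := (wproj_cofib wT f).1 cf.
have [|r [rf _]] := model_lift_triv_cofib mT (u := idm A) (v := 0) tf
  (wproj_fibrant wT A); first exact: to_zobj.
have d0 : d = 0.
  by rewrite -[d]push1 -rf push_comp (push_inflation df) raddf0.
rewrite d0 in df; exists C, y; split=> //; split=> //.
have [s ys] := real0_section df; apply/triv_fibrantE.
apply: (model_weq_retract mT) wf; exists 0, 0, s, y.
split=> //; [exact: from_zobj|exact: from_zobj|].
by rewrite comp0m (real_comp0 df).
Qed.

(** Conversely, write [f = p \oc i]; lifting against the split inflation [i] makes [f] a retract of
    the fibration [p]. *)
Lemma fibE (A C : B) (f : hom A C) : fib T f <-> Fib_ W f.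
Proof.
split; first exact: fib_Fib.
have [Z [i [p [ti fp fE]]]] := model_fact_triv_cofib mT f.
have [D [y [di WD]]] := triv_cofib_real0 ti => ff.
have [|h [hi fh]] := split_lift (u := idm A) (v := p) di WD ff.
  by rewrite compm1.
apply: (model_fib_retract mT) fp; exists i, h, (idm C), (idm C).
by rewrite !comp1m.
Qed.

(** Forward, both factors of [f = p \oc i] lie in [Weq_ W Y], which has two-out-of-three. Backward,
    [f] is [binl A V] followed by a trivial fibration, and [binl A V] is a section of the trivial
    fibration [bprl A V]. *)
Lemma weqE (A C : B) (f : hom A C) : weq T f <-> Weq_ W Y f.
Proof.
have omega : Omega B (X, Y) := Psi_Omega.
have mPhi := Phi_model_structure wic omega.
split=> [wf|].
  have [Z [i [p [ti fp fE]]]] := model_fact_triv_cofib mT f.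
  have [_ ax _] := model_weq_2of3 mT i p.
  have wp : weq T p by apply: ax; [case: ti|rewrite -fE].
  have [ax' _ _] := model_weq_2of3 mPhi i p; rewrite fE; apply: ax'.
    apply: (proj2 ((triv_cofib_split wic omega i).2 _)).
    exact: triv_cofib_real0.
  apply: (deflation_Weq omega); apply/(wproj_triv_fib wT); split=> //.
move=> [V [t [WV dft]]].
have [_ wft] : triv_fib T (copair f t) by apply/(wproj_triv_fib wT).
have [ax _ _] := model_weq_2of3 mT (binl A V) (copair f t).
rewrite -(copair_binl f t); apply: ax => //.
have [_ wpr] : triv_fib T (bprl A V).
  apply/(wproj_triv_fib wT); exists V, (binr A V); split; last by case: WV.
  by exists 0; apply: real0_swap.
have [_ _ ax'] := model_weq_2of3 mT (binl A V) (bprl A V).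
by apply: ax' => //; rewrite binlK; apply: weq_id.
Qed.

Lemma Phi_Psi : Phi (Psi T) = T.
Proof.
have ext (P Q : mor_class B) :
    (forall A C (f : hom A C), P A C f <-> Q A C f) -> P = Q.
  move=> PQ; do 2!apply: functional_extensionality_dep => ?.
  by apply: funext => f; apply: propext.
have eta (U : mor_triple B) :
  MorTriple (@cofib _ U) (@fib _ U) (@weq _ U) = U by case: U.
rewrite -[RHS]eta; congr MorTriple; apply: ext => A C f.
- by split=> /(wproj_cofib wT).
- by split=> /fibE.
- by split=> /weqE.
Qed.

End ModelToCotorsion.

Theorem theorem1p2 (B : extriangulated_category)
    (wicB : weakly_idempotent_complete B) :
  [/\ set_bij (Omega B) (Gamma B) (@Phi B),
      set_bij (Gamma B) (Omega B) (@Psi B),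
      (forall XY, Omega B XY -> Psi (Phi XY) = XY)
    & (forall T, Gamma B T -> Phi (Psi T) = T)].
Proof.
have PhiG XY : Omega B XY -> Gamma B (Phi XY).
  by case: XY => X Y omXY; apply: Phi_Gamma.
have PhiK XY : Omega B XY -> Psi (Phi XY) = XY.
  by case: XY => X Y omXY; apply: Psi_Phi.
have PsiK T : Gamma B T -> Phi (Psi T) = T by move=> gT; apply: Phi_Psi.
have PsiO T : Gamma B T -> Omega B (Psi T) by move=> gT; apply: Psi_Omega.
split=> //; split=> //.
- move=> XY XY' /set_mem om /set_mem om' e.
  by rewrite -(PhiK _ om) -(PhiK _ om') e.
- by move=> T gT; exists (Psi T); [apply: PsiO|apply: PsiK].
- move=> T T' /set_mem gT /set_mem gT' e.
  by rewrite -(PsiK _ gT) -(PsiK _ gT') e.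
- by move=> XY om; exists (Phi XY); [apply: PhiG|apply: PhiK].
Qed.
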